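(* Let $(X,d)$ be a compact metric space containing at least two points and let $f:X\to X$ be a continuous map. If $f$ has mean ergodic shadowing, then $f$ has $M^{\alpha}$-shadowing for each $\alpha\in(0,1)$.
   Context: $\mathbb{N}$ denotes the set of non-negative integers. For $E\subset\mathbb{N}$, the upper density is $\overline{d}(E)=\limsup_{n\to\infty}\frac1n\#(E\cap\{0,\dots,n-1\})$, and $E$ has density zero if $\lim_{n\to\infty}\frac{1}{n}\#(E\cap\{0,\dots,n-1\})=0$. A sequence $\xi=\{x_i\}_{i\in\mathbb{N}}$ in $X$ is a $\delta$-ergodic pseudo orbit for $f$ if the set $\{i\in\mathbb{N}: d(f(x_i),x_{i+1})\ge\delta\}$ has density zero. It is $\epsilon$-shadowed in average by $x\in X$ if $\limsup_{n\to\infty}\frac1n\sum_{i=0}^{n-1}d(f^i(x),x_i)<\epsilon$. $f$ has mean ergodic shadowing if for every $\epsilon>0$ there is $\delta>0$ such that every $\delta$-ergodic pseudo orbit is $\epsilon$-shadowed in average by some point of $X$. $f$ has $M^{\alpha}$-shadowing if for every $\epsilon>0$ there is $\delta>0$ such that for every $\delta$-ergodic pseudo orbit $\xi=\{x_i\}_{i\in\mathbb{N}}$ there is $x\in X$ with $\overline{d}(\{i\in\mathbb{N}: d(f^i(x),x_i)<\epsilon\})>\alpha$. *)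

(* Defs.v *)
From HB Require Import structures.
From mathcomp Require Import all_boot all_order all_algebra.
From mathcomp Require Import all_classical all_reals all_analysis.

Set Implicit Arguments.
Unset Strict Implicit.
Unset Printing Implicit Defensive.

Import Order.TTheory GRing.Theory Num.Theory.
Import numFieldNormedType.Exports.

Local Open Scope classical_set_scope.
Local Open Scope ring_scope.

(* At n = 0 the quotient is 0, since 0^-1 = 0; this is irrelevant for limits
   as n tends to infinity. *)
Definition frequency (R : realType) (E : set nat) (n : nat) : R :=
  #|[pred i : 'I_n | `[< E i >]]|%:R / n%:R.

Definition upper_density (R : realType) (E : set nat) : \bar R :=
  limn_esup (fun n => (frequency R E n)%:E).

Definition density_zero (R : realType) (E : set nat) : Prop :=
  frequency R E n @[n --> \oo] --> (0 : R).

Definition ergodic_pseudo_orbit (R : realType) (X : metricType R) (f : X -> X)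
    (delta : R) (xi : nat -> X) : Prop :=
  density_zero R [set i | delta <= mdist (f (xi i)) (xi i.+1)].

Definition shadowed_in_average (R : realType) (X : metricType R) (f : X -> X)
    (eps : R) (xi : nat -> X) (x : X) : Prop :=
  (limn_esup (fun n =>
     ((\sum_(0 <= i < n) mdist (iter i f x) (xi i)) / n%:R)%:E) < eps%:E)%E.

Definition mean_ergodic_shadowing (R : realType) (X : metricType R)
    (f : X -> X) : Prop :=
  forall eps : R, 0 < eps ->
    exists2 delta : R, 0 < delta &
      forall xi : nat -> X, ergodic_pseudo_orbit f delta xi ->
        exists x : X, shadowed_in_average f eps xi x.

Definition M_shadowing (R : realType) (X : metricType R) (alpha : R)
    (f : X -> X) : Prop :=
  forall eps : R, 0 < eps ->
    exists2 delta : R, 0 < delta &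
      forall xi : nat -> X, ergodic_pseudo_orbit f delta xi ->
        exists x : X,
          (alpha%:E <
           upper_density R [set i | (mdist (iter i f x) (xi i) < eps)%R])%E.

(* Main.v *)
Require Import Defs.
From HB Require Import structures.
From mathcomp Require Import all_boot all_order all_algebra.
From mathcomp Require Import all_classical all_reals all_analysis.

Import Order.TTheory GRing.Theory Num.Theory.
Import numFieldNormedType.Exports.

Local Open Scope classical_set_scope.
Local Open Scope ring_scope.

(** The proof is Markov's inequality for the uniform measure on {0, ..., n-1}.
    Along an orbit with errors a_i = d(f^i(x), x_i) >= 0, the proportion of
    indices i < n with a_i >= eps is at most 1/eps times the average of the
    a_i ([markov_frequency]).  If the upper limit of these averages is below
    eps * (1 - alpha), then they stay below some c < eps * (1 - alpha) from
    some rank on, so the proportion of indices with a_i < eps is eventually at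
    least 1 - c / eps > alpha ([upper_density_gt_of_average]).  Hence, to get
    M^alpha-shadowing at scale eps, it suffices to shadow in average at scale
    eps * (1 - alpha).  The gap between c and eps * (1 - alpha) is what keeps
    the inequality strict when passing to the upper density. *)

Lemma near_le_of_limn_esup_lt {R : realType} (u : nat -> R) (b : R) :
  (limn_esup (fun n => (u n)%:E) < b%:E)%E ->
  exists2 c : R, c < b & \forall n \near \oo, u n <= c.
Proof.
move=> /ereal_inf_lt[_ [V VF <-] supV].
have uV n : V n -> ((u n)%:E <= ereal_sup [set (u k)%:E | k in V])%E.
  by move=> Vn; apply: ereal_sup_ubound; exists n.
have [m Vm] := filter_ex VF.
have := uV m Vm; move: supV uV.
case: (ereal_sup _) => [c| |] //; rewrite lte_fin => cb uV _.
by exists c => //; apply: filterS VF => n /uV; rewrite lee_fin.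
Qed.

Lemma le_limn_esup_of_near {R : realType} (u : nat -> R) (c : R) :
  (\forall n \near \oo, c <= u n) ->
  (c%:E <= limn_esup (fun n => (u n)%:E))%E.
Proof.
move=> cu; apply: le_ereal_inf_tmp => _ [V VF <-].
have [n [Vn cun]] := filter_ex (filterI VF cu).
by apply: le_ereal_sup_tmp; exists (u n)%:E; [exists n|rewrite lee_fin].
Qed.

(** Markov's inequality for the uniform measure on {0, ..., n-1}, phrased for
    the complementary event. *)
Lemma markov_frequency {R : realType} (a : nat -> R) (eps : R) (n : nat) :
  0 < eps -> (forall i, 0 <= a i) -> (0 < n)%N ->
  1 - (\sum_(0 <= i < n) a i) / n%:R / eps
    <= frequency R [set i | a i < eps] n.
Proof.
move=> eps0 a0 n0; have nR0 : 0 < n%:R :> R by rewrite ltr0n.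
rewrite /frequency lerBlDr mulrAC -mulrDl ler_pdivlMr// mul1r.
(* Each index contributes at least 1 in total to the count and to the sum
   divided by eps. *)
rewrite -sum1_card natr_sum big_mkcond big_mkord mulr_suml -big_split /=.
rewrite -[X in X%:R <= _]card_ord -sum1_card natr_sum.
apply: ler_sum => i _; rewrite inE; case: asboolP => [_|/negP].
  by rewrite lerDl divr_ge0// ltW.
by rewrite -leNgt add0r ler_pdivlMr// mul1r.
Qed.

Lemma upper_density_gt_of_average {R : realType} (a : nat -> R)
    (eps alpha : R) :
  0 < eps -> (forall i, 0 <= a i) ->
  (limn_esup (fun n => ((\sum_(0 <= i < n) a i) / n%:R)%:E)
     < (eps * (1 - alpha))%:E)%E ->
  (alpha%:E < upper_density R [set i | (a i < eps)%R])%E.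
Proof.
move=> eps0 a0 /near_le_of_limn_esup_lt[c c_lt avg_le].
apply: (@lt_le_trans _ _ (1 - c / eps)%:E).
  by rewrite lte_fin ltrBrDl -ltrBrDr ltr_pdivrMr// mulrC.
apply: le_limn_esup_of_near.
apply: filterS2 avg_le (nbhs_infty_gt 0) => n avg_n n0.
apply: le_trans (markov_frequency a eps n eps0 a0 n0).
by rewrite lerD2l lerN2 ler_pM2r// invr_gt0.
Qed.

Theorem proposition3p8 (R : realType) (X : metricType R) (f : X -> X)
  (hX : compact [set: X]) (hX2 : exists x y : X, x <> y)
  (hf : continuous f) (hmes : mean_ergodic_shadowing f) :
  forall alpha : R, 0 < alpha < 1 -> M_shadowing alpha f.
Proof.
move=> alpha /andP[_ alpha1] eps eps0.
have eta0 : 0 < eps * (1 - alpha) by rewrite mulr_gt0// subr_gt0.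
have [delta delta0 shadow] := hmes _ eta0.
exists delta => // xi /shadow[x avg_x]; exists x.
by apply: upper_density_gt_of_average avg_x => // i; exact: mdist_ge0.
Qed.
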